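(* For all $\Delta\geq 9$ and $\epsilon>0$, and for all sufficiently large $n>n(\Delta,\epsilon)$, there exists a $\Delta$-regular $n$-vertex graph $G$ with slope parameter $$\mathsf{sl}(G)>\tfrac{1}{4}\bigl((1-\epsilon)\Delta-8\bigr)n.$$
   Context: Graphs are undirected, finite and simple. For a set $P\subseteq\mathbb{R}^2$ of points in the plane and a set $S\subset\mathbb{R}\cup\{\infty\}$ of slopes, $G(P,S)$ is the graph with vertex set $P$ in which two distinct points $v,w\in P$ are adjacent if and only if the slope of the line $\overline{vw}$ is in $S$. The slope parameter $\mathsf{sl}(G)$ of a graph $G$ is the minimum integer $k$ such that $G\cong G(P,S)$ for some point set $P$ and slope set $S$ with $|S|=k$. Here $\Delta$ and $n$ are integers, and $n(\Delta,\epsilon)$ denotes a threshold depending only on $\Delta$ and $\epsilon$.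
   Formalization: The claim is stated for sufficiently large n with Δn even, since for Δ and n both odd (e.g. Δ = 9, n odd) no Δ-regular n-vertex graph exists. *)

(* Defs.v *)
From mathcomp Require Import all_boot all_order all_algebra.
From mathcomp Require Import finmap boolp reals.

Set Implicit Arguments.
Unset Strict Implicit.
Unset Printing Implicit Defensive.

Import Order.TTheory GRing.Theory Num.Theory.

Local Open Scope fset_scope.
Local Open Scope ring_scope.

Record sgraph := SGraph {
  vertex :> finType;
  adj : rel vertex;
  adj_sym : symmetric adj;
  adj_irr : irreflexive adj
}.

Definition isomorphic (G H : sgraph) : Prop :=
  exists2 f : G -> H, bijective f & forall v w, adj (f v) (f w) = adj v w.

Definition regular (d : nat) (G : sgraph) : Prop :=
  forall v : G, #|[set w : G | adj v w]| = d.

Section SlopeGraph.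
Variable R : realType.

(* [None] is the slope oo of vertical lines.  The value at [v = w] is
   irrelevant: [slope] is only used for distinct points. *)
Definition slope (v w : R * R) : option R :=
  if v.1 == w.1 then None else Some ((w.2 - v.2) / (w.1 - v.1)).

Lemma slope_sym v w : slope v w = slope w v.
Proof.
rewrite /slope eq_sym; case: eqP => // _.
by rewrite -[w.2 - _]opprB -[w.1 - _]opprB invrN mulrNN.
Qed.

Variables (P : {fset R * R}) (S : {fset option R}).

Definition slope_adj : rel P :=
  fun v w => (v != w) && (slope (val v) (val w) \in S).

Lemma slope_adj_sym : symmetric slope_adj.
Proof. by move=> v w; rewrite /slope_adj eq_sym slope_sym. Qed.

Lemma slope_adj_irr : irreflexive slope_adj.
Proof. by move=> v; rewrite /slope_adj eqxx. Qed.

Definition slope_graph : sgraph := SGraph slope_adj_sym slope_adj_irr.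

End SlopeGraph.

Definition slope_representable (R : realType) (G : sgraph) (k : nat) : Prop :=
  exists (P : {fset R * R}) (S : {fset option R}),
    isomorphic G (slope_graph P S) /\ #|` S| = k.

Lemma expn2_sidon_lt i j k l : (i < j)%N -> (k < l)%N ->
  (2 ^ i + 2 ^ j = 2 ^ k + 2 ^ l)%N -> (i = k /\ j = l).
Proof.
have aux a b c d : (a < b)%N -> (b < d)%N -> (2 ^ a + 2 ^ b < 2 ^ c + 2 ^ d)%N.
  move=> ab bd; apply: (@leq_trans (2 ^ d)%N); last exact: leq_addl.
  apply: (@leq_trans (2 ^ b.+1)%N); last by rewrite leq_exp2l.
  by rewrite expnS mul2n -addnn ltn_add2r ltn_exp2l.
move=> ij kl e; case: (ltngtP j l) => [jl|lj|jl].
- by have := aux i j k l ij jl; rewrite e ltnn.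
- by have := aux k l i j kl lj; rewrite e ltnn.
by subst l; move/addIn: e => /(@expnI 2 isT) ->.
Qed.

Lemma expn2_sidon i j k l : i != j -> k != l ->
  (2 ^ i + 2 ^ j = 2 ^ k + 2 ^ l)%N -> (i = k /\ j = l) \/ (i = l /\ j = k).
Proof.
rewrite !neq_ltn => /orP[ij|ij] /orP[kl|kl] e.
- by left; apply: expn2_sidon_lt.
- by right; apply: expn2_sidon_lt => //; rewrite e addnC.
- by right; apply/and_comm; apply: expn2_sidon_lt => //; rewrite addnC.
- by left; apply/and_comm; apply: expn2_sidon_lt => //; rewrite addnC e addnC.
Qed.

(* Place the vertices at the points (2^i, 4^i) of the parabola y = x^2: all
   the lines through two of them have distinct slopes, so the slopes of the
   edges represent G. *)
Lemma slope_representable_exists (R : realType) (G : sgraph) :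
  exists k, `[< slope_representable R G k >].
Proof.
pose x (v : G) : R := (2 ^ enum_rank v)%:R.
pose p (v : G) : R * R := (x v, x v ^+ 2).
have x_inj : injective x.
  by move=> v w /eqP; rewrite eqr_nat eqn_exp2l // => /eqP/val_inj/enum_rank_inj.
have p_inj : injective p by move=> v w [/x_inj].
have slopeE v w : v != w -> slope (p v) (p w) = Some (x v + x w).
  move=> vw; rewrite /slope /= (inj_eq x_inj) (negPf vw); congr Some.
  rewrite subr_sqr mulrAC mulfV; last by rewrite subr_eq0 (inj_eq x_inj) eq_sym.
  by rewrite mul1r addrC.
pose P := [fset p v | v in G].
pose S := [fset slope (p u.1) (p u.2) | u in [pred u : G * G | adj u.1 u.2]].
have pP v : p v \in P by apply/imfsetP; exists v.
exists #|` S|; apply/asboolP; exists P, S; split=> //.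
exists (fun v => [` pP v]).
  apply: inj_card_bij; first by move=> v w /(congr1 val) /p_inj.
  by rewrite -cardfE /P card_imfset //= -cardE.
move=> v w; rewrite /= /slope_adj -val_eqE /= (inj_eq p_inj).
have [->|vw /=] := eqVneq v w; first by rewrite adj_irr.
apply/imfsetP/idP => [[[a b] ab]|vw_adj]; last by exists (v, w).
have {}ab : adj a b by [].
have neab : a != b by apply: contraTneq ab => ->; rewrite adj_irr.
rewrite !slopeE // => -[/eqP]; rewrite -!natrD eqr_nat => /eqP.
have ne (c d : G) : c != d -> enum_rank c != enum_rank d :> nat.
  by rewrite (inj_eq val_inj) (inj_eq enum_rank_inj).
by move=> /(expn2_sidon (ne _ _ vw) (ne _ _ neab)) [] [/val_inj/enum_rank_inj->
  /val_inj/enum_rank_inj->]; rewrite // adj_sym.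
Qed.

Definition slope_parameter (R : realType) (G : sgraph) : nat :=
  ex_minn (slope_representable_exists R G).

(* Main.v *)
(** Count graphs on [n] labelled vertices.  If such a graph has slope parameter at
    most [K], its edges are read off the zero pattern of [K n^2] polynomials in
    the [2 n + K] coordinates and slopes, each of which has degree [O(n^2)] in
    every variable.  By linear algebra the number of zero patterns is at most
    the number of monomials of these degrees, so there are at most
    [C^n n^(4n + 2K)] such graphs.  On the other hand the lifts of the complete
    bipartite graph on [Delta + Delta] vertices already give about
    [n^(Delta n / 2)] graphs that are [Delta]-regular; comparing the exponents
    gives the bound. *)

Require Import Defs.
From mathcomp Require Import all_boot all_order all_algebra.
From mathcomp Require Import fingroup perm finmap boolp reals.
From mathcomp Require Import zify lra.

Set Implicit Arguments.
Unset Strict Implicit.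
Unset Printing Implicit Defensive.

Import Order.TTheory GRing.Theory Num.Theory.
Local Open Scope ring_scope.

(** * Counting zero patterns by linear algebra *)

(* With [x Z] a witness of the pattern [Z], the matrix of the values at the [x Z']
   of the products of the [f i], [i \in Z], is triangular for inclusion, hence of
   full rank, and it factors through the space of functions spanned by [e]. *)
Lemma card_zero_patterns (F : fieldType) (I M : finType) (X : Type)
    (e : M -> X -> F) (f : I -> X -> F) (P : {set {set I}}) :
  (forall Z : {set I}, exists c : M -> F,
     forall x, \prod_(i in Z) f i x = \sum_m c m * e m x) ->
  (forall Z, Z \in P -> exists x, forall i, (i \in Z) = (f i x != 0)) ->
  (#|P| <= #|M|)%N.
Proof.
move=> /choice[c cP] P_real.
have /choice[x xP] (k : 'I_#|P|) :
    exists x, forall i, (i \in enum_val k) = (f i x != 0).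
  exact/P_real/enum_valP.
pose C := \matrix_(k < #|P|, m < #|M|) c (enum_val k) (enum_val m).
pose E := \matrix_(m < #|M|, k < #|P|) e (enum_val m) (x k).
have CE k l : (C *m E) k l = \prod_(i in enum_val k) f i (x l).
  rewrite cP mxE (reindex _ (onW_bij _ (enum_rank_bij M))) /=.
  by apply: eq_bigr => m _; rewrite !mxE enum_rankK.
suff free : row_free (C *m E).
  by rewrite -(eqP free) (leq_trans (mulmx_max_rank _ _)).
apply: inj_row_free => v vCE0.
apply/rowP => k; rewrite mxE; apply/eqP/negPn/negP => vk_neq0.
(* Take a smallest set among those with nonzero coefficient: every other one has an element outside
   it, so only the diagonal entry survives in column [l]. *)
have [l vl_neq0 l_min] := @arg_minnP _ k (fun j => v 0 j != 0)
  (fun j : 'I_#|P| => #|enum_val j|) vk_neq0.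
have /eqP := congr1 (fun w : 'rV_#|P| => w 0 l) vCE0.
rewrite [X in X == _]mxE [X in _ == X]mxE (bigD1 l) //= big1 ?addr0; last first.
  move=> j jl; have [->|/l_min lj] := eqVneq (v 0 j) 0; first by rewrite mul0r.
  have [i ij il] : exists2 i, i \in enum_val j & i \notin enum_val l.
    apply/subsetPn; apply: contraNN jl => jl; apply/eqP/enum_val_inj/eqP.
    by rewrite eqEcard jl lj.
  rewrite CE (bigD1 i) //=; move: il; rewrite xP negbK => /eqP ->.
  by rewrite mul0r mulr0.
rewrite mulf_eq0 (negPf vl_neq0) CE prodf_seq_eq0 /= => /hasP[i _ /andP[]].
by rewrite xP => /negPf ->.
Qed.

(** * Functions of bounded degree in each variable *)

(** Polynomials are explicit lists of coefficients and exponents, repetitions allowed. Bounding each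
    variable separately makes the admissible exponents a box, which is easy to count. *)
Definition bounded_degrees (F : fieldType) (V : finType) (b : V -> nat)
    (g : (V -> F) -> F) :=
  exists2 s : seq (F * {ffun V -> nat}),
    (forall t, t \in s -> forall v, (t.2 v <= b v)%N) &
    forall x, g x = \sum_(t <- s) t.1 * \prod_v x v ^+ t.2 v.

Section BoundedDegrees.
Variables (F : fieldType) (V : finType).
Implicit Types (b : V -> nat) (g : (V -> F) -> F).

Lemma bounded_degreesW b b' g : (forall v, b v <= b' v)%N ->
  bounded_degrees b g -> bounded_degrees b' g.
Proof.
move=> bb' [s sb gE]; exists s => // t ts v.
exact: leq_trans (sb t ts v) (bb' v).
Qed.

Lemma bounded_degrees1 b : bounded_degrees b (fun=> 1 : F).
Proof.
exists [:: (1, [ffun=> 0%N])] => [t|x].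
  by rewrite inE => /eqP -> v /=; rewrite ffunE.
by rewrite big_seq1 mul1r big1 // => v _; rewrite ffunE.
Qed.

Lemma bounded_degrees_var b u : (0 < b u)%N ->
  bounded_degrees b (fun x : V -> F => x u).
Proof.
move=> bu; exists [:: (1, [ffun v => nat_of_bool (v == u)])] => [t|x].
  rewrite inE => /eqP -> v /=; rewrite ffunE.
  by have [->|] := eqVneq.
rewrite big_seq1 mul1r (bigD1 u) //= ffunE eqxx expr1 big1 ?mulr1 // => v.
by rewrite ffunE => /negPf ->.
Qed.

Lemma bounded_degreesB b g h : bounded_degrees b g -> bounded_degrees b h ->
  bounded_degrees b (fun x => g x - h x).
Proof.
move=> [s sb gE] [r rb hE].
exists (s ++ [seq (- t.1, t.2) | t <- r]) => [t|x].
  rewrite mem_cat => /orP[/sb//|/mapP[t' /rb + ->]]; exact.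
rewrite big_cat big_map gE hE -sumrN; congr (_ + _).
by apply: eq_bigr => t _; rewrite mulNr.
Qed.

Lemma bounded_degreesM b c g h : bounded_degrees b g -> bounded_degrees c h ->
  bounded_degrees (fun v => b v + c v)%N (fun x => g x * h x).
Proof.
move=> [s sb gE] [r rb hE].
pose mul (t t' : F * {ffun V -> nat}) : F * {ffun V -> nat} :=
  (t.1 * t'.1, [ffun v => t.2 v + t'.2 v]%N).
exists [seq mul t t' | t <- s, t' <- r].
  move=> t /allpairsP[[t1 t2] [/sb t1b /rb t2b ->]] v /=.
  by rewrite ffunE leq_add.
move=> x; rewrite big_allpairs_dep gE hE big_distrl /=; apply: eq_bigr => t _.
rewrite big_distrr /=; apply: eq_bigr => t' _.
under [in RHS]eq_bigr do rewrite ffunE exprD.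
by rewrite big_split mulrACA.
Qed.

(** The bound sums over all of [I], so that the same monomials serve for every [Z]. *)
Lemma bounded_degrees_prod (I : finType) (b : I -> V -> nat)
    (g : I -> (V -> F) -> F) (Z : {set I}) :
  (forall i, bounded_degrees (b i) (g i)) ->
  bounded_degrees (fun v => \sum_i b i v)%N (fun x => \prod_(i in Z) g i x).
Proof.
move=> gb; elim: (index_enum I) => [|i r IHr].
  have [s sb sE] := bounded_degrees1 (fun=> 0%N); exists s => [t ts v|x].
    by rewrite big_nil sb.
  by rewrite big_nil; exact: sE.
have [iZ|iZ] := boolP (i \in Z); last first.
  have [s sb sE] := IHr; exists s => [t ts v|x].
    by rewrite big_cons (leq_trans (sb t ts v)) ?leq_addl.
  by rewrite big_cons (negPf iZ) sE.
have [s sb sE] := bounded_degreesM (gb i) IHr.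
exists s => [t ts v|x]; first by rewrite big_cons sb.
by rewrite big_cons iZ -sE.
Qed.

End BoundedDegrees.

Lemma bounded_degrees_monomials (F : fieldType) (V : finType) (B : nat)
    (g : (V -> F) -> F) : bounded_degrees (fun=> B) g ->
  exists c : {ffun V -> 'I_B.+1} -> F,
    forall x, g x = \sum_m c m * \prod_v x v ^+ m v.
Proof.
move=> [s sb gE].
pose m (t : F * {ffun V -> nat}) : {ffun V -> 'I_B.+1} :=
  [ffun v => inord (t.2 v)].
exists (fun m0 => \sum_(t <- s | m t == m0) t.1) => x.
rewrite gE (partition_big m predT) //=; apply: eq_bigr => m0 _.
rewrite big_distrl /= big_seq_cond [RHS]big_seq_cond.
apply: eq_bigr => t /andP[ts /eqP <-]; congr (_ * _).
by apply: eq_bigr => v _; rewrite ffunE inordK // ltnS sb.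
Qed.

Lemma card_zero_patterns_bounded (F : fieldType) (V I : finType) (B : nat)
    (b : I -> V -> nat) (f : I -> (V -> F) -> F) (P : {set {set I}}) :
  (forall i, bounded_degrees (b i) (f i)) ->
  (forall v, \sum_i b i v <= B)%N ->
  (forall Z, Z \in P -> exists x, forall i, (i \in Z) = (f i x != 0)) ->
  (#|P| <= B.+1 ^ #|V|)%N.
Proof.
move=> fb bB P_real; rewrite -[B.+1]card_ord -card_ffun.
apply: (card_zero_patterns _ P_real) => Z; apply: bounded_degrees_monomials.
exact: bounded_degreesW bB (bounded_degrees_prod Z fb).
Qed.

(** * Slope graphs as zero patterns *)

Section SlopePatterns.
Variables (R : realType) (T : finType) (K : nat).

(* The variables are the abscissas, the ordinates and [K] slopes; the slots outside
   [A] stand for the vertical slope. *)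
Definition slope_eqn (A : {set 'I_K}) (i : T * T * 'I_K)
    (p : T + T + 'I_K -> R) : R :=
  let x u := p (inl (inl u)) in let y u := p (inl (inr u)) in
  let: (v, w, l) := i in
  if l \in A then (y w - y v) - p (inr l) * (x w - x v) else x w - x v.

(** The diagonal is left out because every [slope_eqn] vanishes there. *)
Definition slope_model (e : rel T) (A : {set 'I_K}) (p : T + T + 'I_K -> R) :=
  forall v w, v != w -> e v w = [exists l, slope_eqn A (v, w, l) p == 0].

Definition slope_eqn_degree (i : T * T * 'I_K) (z : T + T + 'I_K) : nat :=
  match z with
  | inl (inl u) => (u == i.1.1) + (u == i.1.2)
  | inl (inr u) => (u == i.1.1) + (u == i.1.2)
  | inr l => l == i.2
  end.

Lemma slope_eqn_bounded A i :
  bounded_degrees (slope_eqn_degree i) (slope_eqn A i).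
Proof.
case: i => [[v w] l] /=; rewrite /slope_eqn.
have var u : (0 < slope_eqn_degree (v, w, l) u)%N ->
    bounded_degrees (slope_eqn_degree (v, w, l))
      (fun p : T + T + 'I_K -> R => p u) by exact: bounded_degrees_var.
case: (l \in A); last first.
  by apply: bounded_degreesB; apply: var; rewrite /= eqxx ?addn1.
apply: bounded_degreesB.
  by apply: bounded_degreesB; apply: var; rewrite /= eqxx ?addn1.
pose bs (z : T + T + 'I_K) : nat := z == inr l.
pose bx (z : T + T + 'I_K) :=
  (if z is inl (inl u) then (u == v) + (u == w) else 0)%N.
apply: (bounded_degreesW (b := fun z => bs z + bx z)%N).
  by case=> [[u|u]|k]; rewrite /bs /bx //= addn0.
apply: bounded_degreesM; first by apply: bounded_degrees_var; rewrite /bs eqxx.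
by apply: bounded_degreesB; apply: bounded_degrees_var; rewrite /= eqxx ?addn1.
Qed.

(** A coordinate of [u] is charged once for each end equal to [u], a slope once for each pair of
    ends; adding the two totals covers both cases. *)
Lemma sum_slope_eqn_degree z :
  (\sum_i slope_eqn_degree i z <= 2 * #|T| * K + #|T| ^ 2)%N.
Proof.
have sum_eq (U : finType) (u : U) : (\sum_(u' : U) (u == u'))%N = 1%N.
  by rewrite (bigD1 u) //= eqxx big1 // => u' /negPf; rewrite eq_sym => ->.
have sum_xy u : (\sum_(i : T * T * 'I_K) ((u == i.1.1) + (u == i.1.2)))%N
    = (2 * #|T| * K)%N.
  rewrite -(pair_bigA _ (fun (i : T * T) (l : 'I_K) =>
    (u == i.1) + (u == i.2))%N) /=.
  under eq_bigr do rewrite sum_nat_const card_ord.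
  rewrite -big_distrr /= -(pair_bigA _ (fun v w => (u == v) + (u == w))%N) /=.
  under eq_bigr do rewrite big_split sum_eq sum_nat_const.
  by rewrite big_split -big_distrr /= sum_eq sum_nat_const
    !muln1 addnn -mul2n mulnC.
case: z => [[u|u]|l]; rewrite /slope_eqn_degree.
- by rewrite sum_xy leq_addr.
- by rewrite sum_xy leq_addr.
rewrite -(pair_bigA _ (fun (i : T * T) (l' : 'I_K) => (l == l') : nat)) /=.
under eq_bigr do rewrite sum_eq.
by rewrite sum_nat_const card_prod muln1 mulnn leq_addl.
Qed.

(** Sort the relations by their set [A], one of [2 ^ K]. Once [A] is fixed, so are the equations,
    and their zero pattern determines the relation. *)
Lemma card_slope_models (Q : finType) (e : Q -> rel T) :
  (forall a b, (forall v w, v != w -> e a v w = e b v w) -> a = b) ->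
  (forall a, exists A p, slope_model (e a) A p) ->
  (#|Q| <= 2 ^ K * (2 * #|T| * K + #|T| ^ 2).+1 ^ (2 * #|T| + K))%N.
Proof.
move=> e_inj /choice[A /choice[p e_model]].
pose Z a := [set i | slope_eqn (A a) i (p a) != 0].
rewrite -sum1_card (partition_big A predT) //=.
have -> : (2 ^ K = \sum_(B : {set 'I_K}) 1)%N.
  by rewrite sum1_card -cardsT -powersetT card_powerset cardsT card_ord.
rewrite big_distrl /=; apply: leq_sum => B _; rewrite mul1n.
have -> : (2 * #|T| + K = #|{: T + T + 'I_K}|)%N.
  by rewrite !card_sum card_ord addnn mul2n.
have Z_inj : {in [pred a | A a == B] &, injective Z}.
  move=> a b /eqP aB /eqP bB /setP Zab; apply: e_inj => v w vw.
  rewrite !e_model //; apply: eq_existsb => l.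
  by have := Zab (v, w, l); rewrite !inE aB bB => /negb_inj.
rewrite sum1_card -(card_in_imset Z_inj).
apply: (card_zero_patterns_bounded (f := slope_eqn B) (b := @slope_eqn_degree)).
- exact: slope_eqn_bounded.
- exact: sum_slope_eqn_degree.
move=> _ /imsetP[a /eqP <- ->]; exists (p a) => i.
by rewrite inE.
Qed.

End SlopePatterns.

(** Padding to exactly [K] slots gives graphs with different slope parameters the same variables. *)
Lemma slope_representable_model (R : realType) (G : sgraph) (k K : nat)
    (v0 w0 : G) : adj v0 w0 -> (k <= K)%N -> slope_representable R G k ->
  exists A (p : G + G + 'I_K -> R), slope_model (@adj G) A p.
Proof.
move=> v0w0 kK [P [S [[f f_bij f_adj] cardS]]].
pose s0 := slope (val (f v0)) (val (f w0)).
have s0S : s0 \in S by have := f_adj v0 w0; rewrite v0w0 => /andP[].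
(* An edge gives a slope [s0], used to fill the slots left when [k < K]. *)
pose s (l : 'I_K) := nth s0 (enum_fset S) l.
have sS t : (t \in S) = [exists l, s l == t].
  apply/idP/existsP => [tS|[l /eqP <-]]; last first.
    rewrite /s; have [lt|ge] := ltnP l (size (enum_fset S)).
      exact: mem_nth.
    by rewrite nth_default.
  have lt : (index t (enum_fset S) < K)%N.
    by apply: leq_trans kK; rewrite -cardS index_mem.
  by exists (Ordinal lt); rewrite /s nth_index.
(* The default 0 for the slope oo is never read: those slots lie outside [A]. *)
exists [set l | s l != None], (fun z => match z with
  | inl (inl u) => (val (f u)).1
  | inl (inr u) => (val (f u)).2
  | inr l => odflt 0 (s l)
  end) => v w vw.
rewrite -f_adj /= /slope_adj (bij_eq f_bij) vw /= sS.
apply: eq_existsb => l; rewrite /slope_eqn inE /slope.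
have fvw : val (f v) != val (f w) by rewrite (inj_eq val_inj) (bij_eq f_bij).
case: (s l) => [t|] /=; last first.
  rewrite subr_eq0 [RHS]eq_sym; case: ifP => //.
(* With equal abscissas, a finite slot would force equal ordinates too, but the points are
   distinct. *)
have [xvw|xvw] := eqVneq (val (f v)).1 (val (f w)).1.
  rewrite xvw subrr mulr0 subr0 subr_eq0 eq_sym; apply/esym/negbTE.
  by apply: contraNN fvw => /eqP yvw; rewrite -pair_eqE /pair_eq xvw yvw !eqxx.
rewrite (inj_eq Some_inj) subr_eq0 eq_sym.
by rewrite (can2_eq (divfK _) (mulfK _)) // subr_eq0 eq_sym.
Qed.

(** * Regular graphs from lifts *)

Section Lift.
Variables (d t q : nat).

(* Disjoint union of [t] copies of the complete graph on [d.+1] vertices, used to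
   adjust the number of vertices, and of a [q]-fold lift of the complete bipartite
   graph on [d + d] vertices. *)
Definition lift_vertex : finType :=
  ('I_t * 'I_d.+1 + bool * 'I_d * 'I_q)%type.

Implicit Types s : {ffun 'I_d * 'I_d -> {perm 'I_q}}.

(** The boolean is the side of the bipartition; [s (a, b)] matches the fibre over [a] on the [false]
    side with the fibre over [b] on the [true] side. *)
Definition lift_adj s : rel lift_vertex := fun v w =>
  match v, w with
  | inl (c, i), inl (c', j) => (c == c') && (i != j)
  | inr (e, a, i), inr (e', b, j) =>
      (e != e') && (if e then s (b, a) j == i else s (a, b) i == j)
  | _, _ => false
  end.

Lemma lift_adj_sym s : symmetric (lift_adj s).
Proof.
case=> [[c i]|[[e a] i]] [[c' j]|[[e' b] j]] //=.
  by rewrite eq_sym [i == j]eq_sym.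
by case: e e' => [] [].
Qed.

Lemma lift_adj_irr s : irreflexive (lift_adj s).
Proof. by case=> [[c i]|[[e a] i]] /=; rewrite !eqxx. Qed.

Definition lift_graph s : sgraph :=
  SGraph (lift_adj_sym s) (lift_adj_irr s).

Lemma card_lift_graph s : #|lift_graph s| = (d.+1 * t + 2 * d * q)%N.
Proof. by rewrite card_sum !card_prod !card_ord card_bool mulnC. Qed.

(** In the lift, a vertex has exactly one neighbour in each of the [d] opposite fibres. *)
Lemma lift_graph_regular s : regular d (lift_graph s).
Proof.
case=> [[c i]|[[e a] i]].
  pose f (j : 'I_d.+1) : lift_vertex := inl (c, j).
  have f_inj : injective f by move=> j j' [].
  have -> : [set w : lift_graph s | lift_adj s (inl (c, i)) w] = f @: [set~ i].
    apply/setP => w; rewrite inE; apply/idP/imsetP => [|[j + ->]].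
      by case: w => [[c' j]|//] /andP[/eqP <- ij]; exists j; rewrite // !inE eq_sym.
    by rewrite !inE /= eqxx eq_sym.
  by rewrite card_imset // cardsC1 card_ord.
pose f (b : 'I_d) : lift_vertex :=
  inr (~~ e, b, if e then (s (b, a))^-1%g i else s (a, b) i).
have f_inj : injective f by move=> b b' [].
have -> : [set w : lift_graph s | lift_adj s (inr (e, a, i)) w] = f @: setT.
  apply/setP => w; rewrite inE; apply/idP/imsetP => [|[b _ ->]].
    case: w => [//|[[e' b] j]] /= /andP[ee' sj]; exists b => //; rewrite /f.
    by case: (e) ee' sj; case: (e') => // _ /eqP <-; rewrite ?permK.
  by rewrite /f /=; case: (e) => //=; rewrite ?permKV eqxx.
by rewrite card_imset // cardsT card_ord.
Qed.

Lemma lift_adj_inj s s' :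
  (forall v w, v != w -> lift_adj s v w = lift_adj s' v w) -> s = s'.
Proof.
move=> ss'; apply/ffunP => -[a b]; apply/permP => i.
have := ss' (inr (false, a, i)) (inr (true, b, s (a, b) i)) isT.
by rewrite /= eqxx => /esym/eqP.
Qed.

Lemma card_lifts :
  #|{ffun 'I_d * 'I_d -> {perm 'I_q}}| = (q`! ^ (d * d))%N.
Proof. by rewrite card_ffun card_prod !card_ord card_Sn. Qed.

End Lift.

(** * Comparison of the two counts *)

(** The falling factorial of [2 * q] of length [q] is at least [q ^ q], and equals a binomial
    coefficient, at most [4 ^ q], times the factorial of [q]. *)
Lemma expnn_le_fact q : (q ^ q <= 4 ^ q * q`!)%N.
Proof.
have ffact_ge m : (q ^ m <= (q + m) ^_ m)%N.
  elim: m => // m IHm; rewrite addnS ffactSS expnS leq_mul //; lia.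
apply: leq_trans (ffact_ge q) _; rewrite -bin_ffact leq_mul2r; apply/orP; right.
rewrite addnn -mul2n (_ : 4 = (1 + 1) ^ 2)%N // -expnM expnDn.
have q2 : (q < (2 * q).+1)%N by lia.
by rewrite (bigD1 (Ordinal q2)) //= !exp1n !muln1 leq_addr.
Qed.

(* The last hypothesis reads [K <= ((1 - 1 / p) d - 8) n / 4]. *)
Lemma slope_models_lt_lifts (d p : nat) : (0 < d)%N -> (0 < p)%N ->
  exists n0 : nat, forall n r q K : nat, (n0 < n)%N ->
    n = (r + 2 * d * q)%N -> (r <= 2 * d * d.+1)%N ->
    (p * (4 * K + 8 * n) + d * n <= p * d * n)%N ->
  (2 ^ K * (2 * n * K + n ^ 2).+1 ^ (2 * n + K) < q`! ^ (d * d))%N.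
Proof.
move=> d_gt0 p_gt0.
(* As [K <= d * n], [M * n ^ 2] bounds the base and [C ^ n] the constant factors of the count; [E]
   collects the constants of [le2] and [le3]. *)
pose M := (2 * d + 2)%N; pose C := (2 ^ d * M ^ (2 + d))%N.
pose E := ((16 * d) ^ (p * d) * C ^ (2 * p))%N.
pose r0 := (2 * d * d.+1)%N.
exists (E ^ 2 + 2 * p * r0 + 2 * r0)%N => n r q K n_gt nE r_le K_le.
rewrite -/r0 in r_le; have n_gt0 : (0 < n)%N by lia.
have pr0 : (2 * p * r <= n)%N.
  by apply: (@leq_trans (2 * p * r0)); [rewrite leq_mul2l r_le orbT | lia].
have rn : (2 * r <= n)%N by lia.
have Kdn : (K <= d * n)%N.
  have : (p * (4 * K) <= p * (d * n))%N by rewrite (mulnA p d); lia.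
  by rewrite leq_pmul2l //; lia.
have base : ((2 * n * K + n ^ 2).+1 <= M * n ^ 2)%N by rewrite /M -mulnn; nia.
have upper : (2 ^ K * (2 * n * K + n ^ 2).+1 ^ (2 * n + K)
              <= C ^ n * n ^ (4 * n + 2 * K))%N.
  apply: (@leq_trans (2 ^ K * (M * n ^ 2) ^ (2 * n + K))%N).
    by rewrite leq_mul2l leq_exp2r ?base ?orbT //; lia.
  rewrite expnMn mulnA -expnM (_ : 2 * (2 * n + K) = 4 * n + 2 * K)%N; last lia.
  rewrite leq_mul2r; apply/orP; right.
  rewrite /C expnMn -!expnM leq_mul // leq_pexp2l ?/M ?addn2 //.
  by rewrite mulnDl leq_add2l.
apply: leq_ltn_trans upper _; rewrite ltnNge; apply/negP => le1.
pose m := (2 * d * q)%N.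
have nm : n = (r + m)%N by [].
have m_gt0 : (0 < m)%N by clear -nm rn n_gt0; lia.
have q_gt0 : (0 < q)%N by move: m_gt0; rewrite muln_gt0 => /andP[].
pose Q := (q`! ^ (2 * p * (d * d)))%N.
have Q_gt0 : (0 < Q)%N by rewrite expn_gt0 fact_gt0.
(* Raising to the power [2 * p] clears denominators, so the hypothesis on [K] bounds the exponent of
   [n]. *)
have le2 : (n ^ (d * n) * Q <= C ^ (2 * p * n) * n ^ (p * d * n))%N.
  have le2 : (Q <= C ^ (2 * p * n) * n ^ (p * (4 * K + 8 * n)))%N.
    have : ((q`! ^ (d * d)) ^ (2 * p) <=
      (C ^ n * n ^ (4 * n + 2 * K)) ^ (2 * p))%N.
      by rewrite leq_exp2r // muln_gt0.
    rewrite expnMn -!expnM /Q.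
    have -> : (d * d * (2 * p) = 2 * p * (d * d))%N by lia.
    have -> : (n * (2 * p) = 2 * p * n)%N by lia.
    by have -> : ((4 * n + 2 * K) * (2 * p) = p * (4 * K + 8 * n))%N by lia.
  apply: leq_trans (leq_mul (leqnn _) le2) _.
  by rewrite mulnCA leq_mul2l -expnD leq_pexp2l ?orbT // addnC.
have le3 : (n ^ (p * d * m) <= (16 * d) ^ (p * d * n) * Q)%N.
  have n4dq : (n <= 4 * d * q)%N by clear -nE rn; lia.
  apply: (@leq_trans ((4 * d * q) ^ (p * d * m))%N).
    by rewrite leq_exp2r // !muln_gt0 p_gt0 d_gt0.
  apply: (@leq_trans ((16 * d) ^ (p * d * m) * Q)%N); last first.
    rewrite leq_mul2r leq_pexp2l ?orbT // ?muln_gt0 //.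
    by rewrite leq_mul2l nm leq_addl orbT.
  rewrite (expnMn (4 * d) q) (_ : 16 * d = 4 * d * 4)%N; last by clear; lia.
  rewrite (expnMn (4 * d) 4) -[leqRHS]mulnA leq_mul2l; apply/orP; right.
  have -> : (p * d * m = q * (2 * p * (d * d)))%N by rewrite /m; clear; lia.
  by rewrite !(expnM _ q) -expnMn leq_exp2r ?expnn_le_fact // !muln_gt0 p_gt0 d_gt0.
(* Multiply [le2] by [le3] and cancel; of [n = r + m] only [r] stays in the exponent. *)
have le4 : (n ^ (d * n) <= E ^ n * n ^ (p * d * r))%N.
  have X_gt0 : (0 < n ^ (p * d * m) * Q)%N by rewrite muln_gt0 expn_gt0 n_gt0 Q_gt0.
  rewrite -(leq_pmul2r X_gt0).
  have := leq_mul le2 le3.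
  rewrite /E (expnMn (_ ^ _)) -!expnM.
  have -> : (p * d * n = p * d * r + p * d * m)%N by rewrite nm mulnDr.
  rewrite !expnD; clear; lia.
(* Since [2 * p * r <= n], squaring [le4] lets one factor [n ^ (d * n)] absorb the remaining power
   of [n]. *)
have le5 : (n ^ (d * n) <= (E ^ 2) ^ n)%N.
  have X_gt0 : (0 < n ^ (d * n))%N by rewrite expn_gt0 n_gt0.
  rewrite -(leq_pmul2r X_gt0) mulnn.
  apply: (@leq_trans ((E ^ n * n ^ (p * d * r)) ^ 2)%N).
    by rewrite leq_exp2r.
  rewrite expnMn -!expnM [(n * 2)%N]mulnC leq_mul2l leq_pexp2l ?orbT //.
  by have := leq_mul (leqnn d) pr0; lia.
move: le5; rewrite expnM leq_exp2r // leqNgt => /negP; apply.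
apply: (@leq_trans n).
  by apply: leq_ltn_trans n_gt; rewrite -addnA leq_addr.
by rewrite -{1}[n]expn1 leq_pexp2l.
Qed.

(** The parity hypothesis is forced: the degrees of a graph have an even sum. *)
Theorem theorem6 (R : realType) (Delta : nat) (eps : R)
    (hDelta : (9 <= Delta)%N) (heps : 0 < eps) :
  exists n0 : nat, forall n : nat, (n0 < n)%N -> ~~ odd (Delta * n) ->
    exists G : sgraph,
      [/\ #|G| = n, regular Delta G
        & 1 / 4 * ((1 - eps) * Delta%:R - 8) * n%:R
            < (slope_parameter R G)%:R :> R].
Proof.
have d_gt0 : (0 < Delta)%N by exact: leq_trans hDelta.
(* This makes [1 / p] at most [eps], so [1 - eps] can be replaced by the rational [1 - 1 / p]. *)
pose p := (Num.truncn eps^-1).+1.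
have p_eps : 1 <= p%:R * eps.
  by rewrite -ler_pdivrMr // div1r ltW // -truncn_lt_nat // invr_ge0 ltW.
have [n0 n0P] := slope_models_lt_lifts d_gt0 (ltn0Sn _ : (0 < p)%N).
(* The added term ensures [Delta.+1 * t <= n], so the subtraction in [q] is not truncated. *)
exists (n0 + 2 * Delta * Delta.+1)%N => n n_gt dn_even.
(* As [Delta * n] is even, [Delta.+1 ^ 2 * n] is congruent to [n] mod [2 * Delta]. *)
pose t := ((Delta.+1 * n) %% (2 * Delta))%N.
pose q := ((n - Delta.+1 * t) %/ (2 * Delta))%N.
have r_le : (Delta.+1 * t <= 2 * Delta * Delta.+1)%N.
  by rewrite mulnC leq_mul2r /= ltnW // ltn_mod muln_gt0.
have nE : (Delta.+1 * t + 2 * Delta * q)%N = n.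
  have r_le_n : (Delta.+1 * t <= n)%N by lia.
  rewrite mulnC [(_ * q)%N]mulnC divnK ?(mulnC t) ?subnKC //.
  rewrite -eqn_mod_dvd // eq_sym /t modnMmr mulnA.
  have -> : (Delta.+1 * Delta.+1 * n = Delta * (Delta * n + 2 * n) + n)%N by lia.
  rewrite -[(Delta * n)%N]odd_double_half (negPf dn_even) -mul2n -mulnDr.
  by rewrite mulnCA mulnA mulnC modnMDl.
have cardG (s : {ffun 'I_Delta * 'I_Delta -> {perm 'I_q}}) : #|lift_graph t s| = n.
  by rewrite card_lift_graph.
have n_gt0 : (0 < n)%N by lia.
(* Otherwise every lift has slope parameter at most [bound], hence at most its integer part [K], and
   the lifts outnumber the slope models. *)
apply: contrapT => no_graph.
pose bound : R := 1 / 4 * ((1 - eps) * Delta%:R - 8) * n%:R.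
have sl_le s : (slope_parameter R (@lift_graph Delta t q s))%:R <= bound.
  rewrite leNgt; apply/negP => sl_gt; apply: no_graph.
  exists (lift_graph t s); split=> //; exact: lift_graph_regular.
have bound_ge0 : 0 <= bound := le_trans (ler0n _ _) (sl_le [ffun=> 1%g]).
pose K := Num.truncn bound.
have K_le : (p * (4 * K + 8 * n) + Delta * n <= p * Delta * n)%N.
  rewrite -(ler_nat R) !(natrD, natrM).
  have : K%:R <= bound by rewrite truncn_le.
  have : 0 <= (p%:R * eps - 1) * (Delta%:R * n%:R) :> R.
    by rewrite mulr_ge0 ?subr_ge0 // mulr_ge0.
  have : (0 : R) <= p%:R by [].
  rewrite /bound; move: (p%:R) (K%:R) (n%:R) (Delta%:R) => P k N D.
  clear; nra.
have r_n0 : (n0 < n)%N by lia.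
have := n0P _ _ _ _ r_n0 (esym nE) r_le K_le; rewrite ltnNge => /negP; apply.
rewrite -(card_lifts Delta q).
have cardT : #|lift_vertex Delta t q| = n by rewrite -(cardG [ffun=> 1%g]).
rewrite -{1 2 3}cardT.
apply: (card_slope_models (R := R) (e := @lift_adj Delta t q)).
  exact: lift_adj_inj.
move=> s.
have /card_gt0P[v _] : (0 < #|lift_graph t s|)%N.
  by rewrite cardG.
have : (0 < #|[set w : lift_graph t s | adj v w]|)%N.
  by rewrite lift_graph_regular.
case/card_gt0P => w; rewrite inE => vw.
apply: (slope_representable_model (k := slope_parameter R (lift_graph t s)) vw).
  by rewrite /K truncn_ge_nat.
by rewrite /slope_parameter; case: ex_minnP => k /asboolP.
Qed.
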